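(* Let $X$ be a compact abelian group and let $\boldsymbol{\varphi} = \langle \varphi_n : n \in \omega\rangle$ be a sequence of distinct elements of $\widehat X$. Then $\widetilde{\mathcal D}_{\mathcal F_{\boldsymbol\varphi}}$ is a Haar null subgroup of $X$.
   Context: $\mathbb T \subset \mathbb C$ is the circle group and $\widehat X$ is the group of continuous homomorphisms $X \to \mathbb T$. For infinite $B \subseteq \widehat X$ and $y\in\mathbb T$, $\mathcal C_B(y)$ is the set of $x \in X$ such that every neighborhood of $y$ contains $\varphi(x)$ for all but finitely many $\varphi \in B$; $\widetilde{\mathcal C}_B = \bigcup_{y \in \mathbb T}\mathcal C_B(y)$. A filter on a set is free iff it contains the complements of finite sets; for a free filter $\mathcal F$ on $\widehat X$, $\widetilde{\mathcal D}_{\mathcal F} = \bigcup\{\widetilde{\mathcal C}_B : B \in \mathcal F\}$. For $E \subseteq \omega$, $d(E) = \lim_{n\to\infty} |E \cap \{0,\dots,n-1\}|/n$ (asymptotic density) when the limit exists. $\mathcal F_{\boldsymbol\varphi}$ is the filter on $\widehat X$ generated by all sets $\{\varphi_n : n \in E\}$ with $E\subseteq\omega$, $d(E) = 1$. ''Haar null'' means of measure $0$ for the (completed) Haar probability measure on $X$. *)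

(* Defs.v *)
From HB Require Import structures.
From mathcomp Require Import all_boot all_order all_algebra.
From mathcomp Require Import complex finmap.
From mathcomp Require Import all_classical all_reals all_analysis.

Set Implicit Arguments.
Unset Strict Implicit.
Unset Printing Implicit Defensive.

Import Order.TTheory GRing.Theory Num.Theory.
Import numFieldNormedType.Exports.
Import ComplexField.

Local Open Scope classical_set_scope.
Local Open Scope ring_scope.

(* The cast to numFieldType selects the topology of the modulus on R[i]; used
   as a type, the set [circle R] carries the subspace topology. *)
Definition circle (R : realType) : set (R[i] : numFieldType) :=
  [set z | `|z| = 1].
Arguments circle R : clear implicits.

(* The topological group X is written additively, the circle
   multiplicatively. *)
Record dual_group (R : realType) (X : topologicalZmodType) := Character {
  char_fun :> X -> circle R;
  char_continuous : continuous char_fun;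
  charD : forall x y : X,
    set_val (char_fun (x + y)) = set_val (char_fun x) * set_val (char_fun y)
}.

Section ConvergencePoints.
Context {R : realType} {X : topologicalZmodType}.
Implicit Types (B : set (dual_group R X)) (F : set_system (dual_group R X)).

(* Meaningful for infinite B only: when B is finite this is all of X. *)
Definition conv_at B (y : circle R) : set X :=
  [set x | forall U : set (circle R), nbhs y U ->
    finite_set (B `&` [set phi : dual_group R X | ~ U (phi x)])].

Definition conv_set B : set X := \bigcup_(y in [set: circle R]) conv_at B y.

(* Intended for a proper F containing the complements of finite sets; all
   members of such an F are infinite. *)
Definition filter_conv_set F : set X := \bigcup_(B in F) conv_set B.

End ConvergencePoints.

Definition has_density (R : realType) (E : set nat) (r : R) :=
  (#|` fset_set (E `&` `I_n)|%:R / n%:R : R) @[n --> \oo] --> r.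

Definition density_filter (R : realType) (T : Type) (phi : nat -> T) :
    set_system T :=
  smallest (@Filter T) [set phi @` E | E in [set E | has_density E (1 : R)]].

Definition borel (X : topologicalZmodType) := g_sigma_algebraType (@open X).

(* The library makes [g_sigma_algebraType] measurable over pointed types. *)
HB.instance Definition _ (X : topologicalZmodType) := Choice.copy (borel X) X.
HB.instance Definition _ (X : topologicalZmodType) :=
  isPointed.Build (borel X) (0 : X).
HB.instance Definition _ (X : topologicalZmodType) := Measurable.copy (borel X)
  (@g_sigma_algebraType (borel X : pointedType) (@open X)).

(* For a finite measure on a compact Hausdorff space, inner regularity entails
   outer regularity, by taking complements. *)
Definition haar_probability (R : realType) (X : topologicalZmodType)
    (mu : probability (borel X) R) : Prop :=
  (forall (x : X) (A : set (borel X)), measurable A ->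
    mu [set x + a | a in (A : set X)] = mu A) /\
  (forall A : set (borel X), measurable A ->
    mu A = ereal_sup
      [set mu K | K in [set K : set X | compact K /\ K `<=` A]]).

(* Main.v *)
Require Import Defs.
From mathcomp Require Import all_boot all_order all_algebra.
From mathcomp Require Import complex finmap.
From mathcomp Require Import all_classical all_reals all_analysis.
From mathcomp Require Import ring lra.
Import Order.TTheory GRing.Theory Num.Theory.
Import numFieldNormedType.Exports.
Import measurable_realfun.
Local Open Scope classical_set_scope.
Local Open Scope ring_scope.

Set Implicit Arguments.
Unset Strict Implicit.
Unset Printing Implicit Defensive.

(** Sets of density 1 are closed under finite intersections, so a set belongs
    to the density filter exactly when it contains the characters indexed by
    some set [E] of density 1 ([density_filterP]). A point [x] is therefore in
    the set [D] of the theorem when [phi n x] converges as [n] runs through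
    such an [E].

    That [D] is a subgroup is continuity of division in the circle: if the
    values at [x] converge along [B] and those at [z] converge along [C], then
    the values at [x - z] converge along [B `&` C] ([conv_atB]).

    For the measure, convergence along a set of density 1 forces the averages
    [1/n * \sum_(i < n) phi i x] to converge to the same limit, which has
    modulus 1, so that [|\sum_(i < n) phi i x|^2 >= n^2 / 4] for all large [n]
    ([filter_conv_char_sum]). On the other hand, distinct characters are
    orthogonal for the Haar measure ([char_orthogonal]), so the function
    [|\sum_(i < n) phi i|^2] has integral [n] ([char_sum_sqr_integral]).
    Markov's inequality bounds by [4 / n] the measure of the points where it
    exceeds [n^2 / 4] ([char_sum_sqr_tail]). The points where it does so for
    every [n >= m] thus form a null set, and [D] is contained in the union over
    [m] of these null sets.

    Integrals are taken of real functions: a character is handled through its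
    real and imaginary parts. *)

(** * Sets of natural numbers of density 1 *)

Lemma count_indicE (R : realType) (E : set nat) n :
  #|` fset_set (E `&` `I_n)|%:R = \sum_(i < n) \1_E (i : nat) :> R.
Proof.
elim: n => [|n IH]; first by rewrite II0 setI0 fset_set0 big_ord0.
rewrite big_ord_recr /= -IH IIS setIUr indicE.
have finE : finite_set (E `&` `I_n) by apply: sub_finite_set (finite_II n).
have [nE|nE] := boolP (n \in E).
  have -> : E `&` [set n] = [set n] by apply/setIidPr => _ ->; exact: set_mem.
  have nI : n \notin E `&` `I_n by rewrite notin_setE => -[_]/=; rewrite ltnn.
  by rewrite setUC fset_setU1// cardfsU1 in_fset_set// nI natrD addrC.
rewrite (_ : E `&` [set n] = set0) ?setU0 ?addr0//.
apply/seteqP; split => // m [Em mn]; move: nE.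
by rewrite -[n]mn notin_setE => /(_ Em).
Qed.

Lemma has_densityE (R : realType) (E : set nat) (r : R) :
  has_density E r <->
  ((\sum_(i < n) \1_E (i : nat)) / n%:R : R) @[n --> \oo] --> r.
Proof.
rewrite /has_density; under eq_fun do rewrite count_indicE.
by [].
Qed.

Lemma has_density_cofinite (R : realType) (A : set nat) :
  finite_set A -> has_density (~` A) (1 : R).
Proof.
move=> finA; apply/has_densityE; apply/cvgrPdist_le => e e0.
pose K : R := #|` fset_set A|%:R.
near=> n; have n0 : 0 < n%:R :> R.
  by rewrite ltr0n; near: n; exact: nbhs_infty_gt.
have -> : \sum_(i < n) \1_(~` A) (i : nat) =
    n%:R - \sum_(i < n) \1_A (i : nat) :> R.
  apply/eqP; rewrite eq_sym subr_eq -big_split/=.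
  rewrite (eq_bigr (fun=> 1)) ?sumr_const ?card_ord// => i _.
  by rewrite !indicE in_setC; case: (_ \in A); rewrite /= ?addr0 ?add0r.
rewrite mulrBl divff ?lt0r_neq0// opprB addrCA subrr addr0.
rewrite ger0_norm ?divr_ge0 ?ler0n ?sumr_ge0// ler_pdivrMr//.
apply: (@le_trans _ _ K).
  rewrite -count_indicE ler_nat; apply: fsubset_leq_card.
  by rewrite -fset_set_sub//; apply: sub_finite_set finA.
rewrite mulrC -ler_pdivrMr//; near: n; exact: nbhs_infty_ger.
Unshelve. all: by end_near. Qed.

(** The count of [A `&` B] below [n] is at least the sum of the counts of [A]
    and [B] minus [n]; dividing by [n] squeezes its density between
    [1 + 1 - 1] and [1]. *)
Lemma has_density1I (R : realType) (A B : set nat) :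
  has_density A (1 : R) -> has_density B (1 : R) ->
  has_density (A `&` B) (1 : R).
Proof.
move=> /has_densityE dA /has_densityE dB; apply/has_densityE.
have dAB := cvgB (cvgD dA dB) (cvg_cst (1 : R)).
rewrite addrK in dAB.
apply: (@squeeze_cvgr _ \oo _ R _ (cst (1 : R))); [|exact: dAB|exact: cvg_cst].
near=> n; have n0 : 0 < n%:R :> R.
  by rewrite ltr0n; near: n; exact: nbhs_infty_gt.
rewrite /= !fctE ler_pdivrMr// mul1r -[X in _ - X](divff (lt0r_neq0 n0)).
rewrite -mulrDl -mulrBl ler_pM2r ?invr_gt0// lerBlDr.
have -> : n%:R = \sum_(i < n) (1 : R) by rewrite sumr_const card_ord.
rewrite -!big_split/=; apply/andP; split; apply: ler_sum => i _.
  rewrite !indicE in_setI.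
  by case: (_ \in A); case: (_ \in B); rewrite /= ?addr0 ?add0r ?ler01.
by rewrite indicE lern1 leq_b1.
Unshelve. all: by end_near. Qed.

(** By [has_density1I], the images of the sets of density 1 already form a
    filter base, so that no intersections are needed to generate the filter. *)
Lemma density_filterP (R : realType) (T : Type) (phi : nat -> T) (B : set T) :
  density_filter R phi B <->
  exists2 E, has_density E (1 : R) & phi @` E `<=` B.
Proof.
split=> [|[E dE EB]]; last first.
  apply: (@filterS _ _ (smallest_filter_filter _) _ _ EB).
  by move=> F [_ imF]; apply: imF; exists E.
apply: (@smallest_sub _ (@Filter T) _
  [set B | exists2 E, has_density E (1 : R) & phi @` E `<=` B]).
  split.
  - exists setT => //; rewrite -setC0.
    exact: has_density_cofinite (finite_set0 _).
  - move=> P Q [E dE EP] [F dF FQ]; exists (E `&` F).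
      exact: has_density1I.
    by move=> _ [n [En Fn] <-]; split; [apply: EP|apply: FQ]; exists n.
  - by move=> P Q PQ [E dE EP]; exists E => //; exact: subset_trans PQ.
by move=> _ [E dE <-]; exists E.
Qed.

(** * The circle *)

Section circle.
Variable R : realType.

(** Radii are real, whereas the balls of [R[i]] have radii in [R[i]]. *)
Lemma circle_nbhsP (y : circle R) (U : set (circle R)) :
  nbhs y U <-> exists2 e : R, 0 < e &
    forall z : circle R, `|set_val z - set_val y : R[i]| < e%:C%C -> U z.
Proof.
split=> [|[e e0 he]].
  rewrite nbhsE/= => -[V [[W oW <-] /= Wy] WU].
  have /nbhs_ballP[e /= e0 he] : nbhs (set_val y : (R[i] : numFieldType)) W.
    by apply: open_nbhs_nbhs; split.
  exists (complex.Re e); first by move: e0; rewrite ltcE => /andP[].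
  move=> z zy; apply: WU; apply: he; rewrite /ball/= distrC.
  by apply: lt_le_trans zy _; rewrite RRe_real// ger0_real//; exact: ltW.
have e0' : 0 < e%:C%C by rewrite ltcR.
pose W := ball (set_val y : (R[i] : numFieldType)) e%:C%C.
rewrite nbhsE; exists (set_val @^-1` W).
  by split; [exists W => //; exact: ball_open|exact: ballxx].
by move=> z /= yz; apply: he; rewrite distrC.
Qed.

Lemma circle_sqrD (y : circle R) :
  complex.Re (set_val y) ^+ 2 + complex.Im (set_val y) ^+ 2 = 1.
Proof.
have y1 : `|set_val y| = 1 :> R[i] := set_valP y.
by have := add_Re2_Im2 (set_val y : R[i]); rewrite y1 expr1n => -[].
Qed.

Lemma Re_continuous : continuous (fun z : circle R => complex.Re (set_val z)).
Proof.
move=> y; apply/(@cvgrPdist_lt _ _ _ (nbhs y) (nbhs_filter y)) => e e0.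
apply/circle_nbhsP; exists e => // z yz.
rewrite distrC -ltcR; apply: (le_lt_trans _ yz).
rewrite (_ : complex.Re _ - _ = complex.Re (set_val z - set_val y)).
  exact: normc_ge_Re.
by case: (set_val z); case: (set_val y).
Qed.

Lemma Im_continuous : continuous (fun z : circle R => complex.Im (set_val z)).
Proof.
move=> y; apply/(@cvgrPdist_lt _ _ _ (nbhs y) (nbhs_filter y)) => e e0.
apply/circle_nbhsP; exists e => // z yz.
rewrite distrC -ltcR; apply: (le_lt_trans _ yz).
rewrite (_ : complex.Im _ - _ =
  complex.Re ((set_val z - set_val y) * - 'i%C)).
  apply: le_trans (normc_ge_Re _) _; rewrite normrM normrN.
  by rewrite [X in _ * X]normc_def /= expr0n expr1n add0r sqrtr1 mulr1.
by case: (set_val z); case: (set_val y) => a b c d /=; ring.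
Qed.

End circle.

(** * Points of convergence form a subgroup *)

Section subgroup.
Variables (R : realType) (X : topologicalZmodType).

Lemma char0 (phi : dual_group R X) : set_val (phi 0) = 1.
Proof.
have := charD phi 0 0; rewrite addr0 => /esym/eqP.
rewrite -[X in _ == X]mulr1 => /eqP /mulfI; apply.
rewrite -normr_eq0.
have -> : `|set_val (phi 0)| = 1 :> R[i] := set_valP (phi 0).
by rewrite oner_eq0.
Qed.

Lemma charB (phi : dual_group R X) x z :
  set_val (phi (x - z)) * set_val (phi z) = set_val (phi x).
Proof. by rewrite -charD subrK. Qed.

(** Since [phi z] has modulus 1, the distance from [phi (x - z)] to [y / w] is
    unchanged when both are multiplied by [phi z]; it is then at most the sum
    of the distances from [phi x] to [y] and from [phi z] to [w]. *)
Lemma conv_atB (B C : set (dual_group R X)) (y w : circle R) (x z : X) :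
  conv_at B y x -> conv_at C w z -> exists v, conv_at (B `&` C) v (x - z).
Proof.
move=> Bx Cz.
have y1 : `|set_val y| = 1 :> R[i] := set_valP y.
have w1 : `|set_val w| = 1 :> R[i] := set_valP w.
have w0 : set_val w != 0 :> R[i] by rewrite -normr_eq0 w1 oner_eq0.
have v1 : circle R (set_val y / set_val w).
  by rewrite /circle /= normrM normfV y1 w1 invr1 mulr1.
exists (SigSub (mem_set v1)) => U /circle_nbhsP[e e0 eU].
pose ball2 (t : circle R) :=
  [set s : circle R | `|set_val s - set_val t : R[i]| < (e / 2)%:C%C].
have ball2_nbhs t : nbhs t (ball2 t).
  by apply/circle_nbhsP; exists (e / 2); rewrite ?divr_gt0.
have fin : finite_set (B `&` [set phi | ~ ball2 y (phi x)] `|`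
    C `&` [set phi | ~ ball2 w (phi z)]).
  by rewrite finite_setU; split; [exact: Bx|exact: Cz].
apply: sub_finite_set fin.
move=> phi [[Bphi Cphi]] /= nU; apply: contrapT => /not_orP.
rewrite /= => -[/not_andP[//|/contrapT xy] /not_andP[//|/contrapT zw]].
apply: nU; apply: eU; rewrite /ball2/= in xy zw *.
have p1 : `|set_val (phi z)| = 1 :> R[i] := set_valP (phi z).
rewrite -[ltLHS]mulr1 -[X in _ * X]p1 -normrM mulrBl charB.
have -> : set_val (phi x) - set_val y / set_val w * set_val (phi z) =
    (set_val (phi x) - set_val y) -
    set_val y / set_val w * (set_val (phi z) - set_val w) :> R[i].
  by field.
apply: le_lt_trans (ler_normB _ _) _.
rewrite [X in _ + X]normrM v1 mul1r.
have -> : e%:C%C = (e / 2)%:C%C + (e / 2)%:C%C by rewrite -rmorphD /= -splitr.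
exact: ltrD.
Qed.

Lemma conv_at0 (B : set (dual_group R X)) : exists y, conv_at B y 0.
Proof.
have one1 : circle R 1 by rewrite /circle /= normr1.
exists (SigSub (mem_set one1)) => U U1.
rewrite (_ : _ `&` _ = set0)//; apply/seteqP; split=> // phi [_] /=; apply.
suff -> : phi 0 = SigSub (mem_set one1).
  by have /circle_nbhsP[e e0] := U1; apply; rewrite subrr normr0 ltcR.
by apply: val_inj; exact: char0.
Qed.

Lemma filter_conv_set_zmod_closed (F : set_system (dual_group R X)) :
  Filter F -> GRing.zmod_closed [in (filter_conv_set F : set X)].
Proof.
move=> FF; split=> [|x z].
  have [y y0] := conv_at0 setT.
  by apply/mem_set; exists setT; [exact: filterT|exists y].
move=> /set_mem[B FB [y _ Bx]] /set_mem[C FC [w _ Cz]].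
have [v BC] := conv_atB Bx Cz.
by apply/mem_set; exists (B `&` C); [exact: filterI|exists v].
Qed.

End subgroup.

(** * Integrating continuous functions against the Haar measure *)

Section continuous_functions.
Variables (R : realType) (X : topologicalZmodType).

Lemma open_borel_measurable (A : set X) :
  open A -> measurable (A : set (borel X)).
Proof. by move=> oA; exact: sub_sigma_algebra. Qed.

Lemma continuous_borel_measurable (f : X -> R) :
  continuous f -> measurable_fun [set: borel X] (f : borel X -> R).
Proof.
move=> /continuousP cf; apply: (measurability _ (RGenOpens.measurableE R)).
move=> _ [_ [a [b ->] <-]]; rewrite setTI; apply: open_borel_measurable.
exact/cf/interval_open.
Qed.

Lemma translation_continuous (a : X) : continuous (fun x : X => a + x).
Proof.
move=> x; apply: (@continuous_comp _ _ _ (fun x => (a, x))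
  (fun z : X * X => z.1 + z.2)); last exact: add_continuous.
by apply: cvg_pair => /=; [exact: cvg_cst|exact: cvg_id].
Qed.

Lemma translation_borel_measurable (a : X) :
  measurable_fun [set: borel X] (fun x : borel X => (a + (x : X)) : borel X).
Proof.
apply: (@measurability _ _ (borel X) (borel X) setT _ (@open X)) => //.
move=> _ [U oU <-]; rewrite setTI; apply: open_borel_measurable.
by move/continuousP: (@translation_continuous a); exact.
Qed.

Lemma continuous_sum (f : nat -> X -> R) n :
  (forall i, continuous (f i)) -> continuous (fun x => \sum_(i < n) f i x).
Proof.
move=> cf; elim: n => [|n IH] x.
  by under eq_fun do rewrite big_ord0; exact: cvg_cst.
under eq_fun do rewrite big_ord_recr /=.
by apply: continuousD; [exact: IH|exact: cf].
Qed.

Hypothesis X_compact : compact [set: X].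
Variable mu : probability (borel X) R.

Lemma continuous_integrable (f : X -> R) : continuous f ->
  mu.-integrable [set: borel X] (EFin \o (f : borel X -> R)).
Proof.
move=> cf; apply: measurable_bounded_integrable => //.
- by apply: le_lt_trans (ltry 1); exact: (probability_le1 mu measurableT).
- exact: continuous_borel_measurable.
have /compact_bounded : compact (f @` setT).
  by apply: continuous_compact => //; apply: continuous_subspaceT.
by case=> M [Mr Mf]; exists M; split=> // x /Mf fx y _; apply: fx; exists y.
Qed.

Lemma Rintegral_sum_continuous (f : nat -> X -> R) n :
  (forall i, continuous (f i)) ->
  \int[mu]_x (\sum_(i < n) f i (x : X)) = \sum_(i < n) \int[mu]_x f i (x : X).
Proof.
move=> cf; elim: n => [|n IH].
  rewrite big_ord0; under eq_Rintegral do rewrite big_ord0.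
  by rewrite Rintegral_cst// mul0r.
under eq_Rintegral do rewrite big_ord_recr/=.
rewrite big_ord_recr /= -IH RintegralD//; apply: continuous_integrable.
  exact: continuous_sum.
exact: cf.
Qed.

Hypothesis mu_haar : haar_probability mu.

(** Invariance of the measure says that [mu] is its own image under the
    translation by [a]. *)
Lemma haar_Rintegral_translate (f : X -> R) (a : X) : continuous f ->
  \int[mu]_x f (a + (x : X)) = \int[mu]_x f (x : X).
Proof.
move=> cf; rewrite /Rintegral; congr fine.
have inv (A : set (borel X)) : measurable A ->
    pushforward mu (fun x : borel X => (a + (x : X)) : borel X) A = mu A.
  move=> mA; rewrite -(mu_haar.1 (- a) A mA) /pushforward; congr (mu _).
  apply/seteqP; split=> [x Ax|_ [x Ax <-]] /=; last by rewrite addNKr.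
  by exists (a + (x : X)); rewrite ?addKr.
rewrite -(integral_pushforward (@translation_borel_measurable a) (mu := mu)
  (D := setT) (f := EFin \o (f : borel X -> R))) //.
- apply: eq_measure_integral; first exact: translation_borel_measurable.
  by move=> ? A mA _; exact: inv.
- by apply/measurable_EFinP; exact: continuous_borel_measurable.
- apply: (@continuous_integrable (f \o (fun x => a + x))) => x.
  by apply: continuous_comp; [exact: translation_continuous|exact: cf].
Qed.

End continuous_functions.

(** * Orthogonality of characters *)

Section characters.
Variables (R : realType) (X : topologicalZmodType).
Implicit Types phi psi : dual_group R X.

Definition charRe phi (x : X) : R := complex.Re (set_val (phi x)).
Definition charIm phi (x : X) : R := complex.Im (set_val (phi x)).

Lemma charRe_continuous phi : continuous (charRe phi).
Proof.
move=> x; apply: (@continuous_comp _ _ _ phi (fun z => complex.Re (set_val z))).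
  exact: char_continuous.
exact: Re_continuous.
Qed.

Lemma charIm_continuous phi : continuous (charIm phi).
Proof.
move=> x; apply: (@continuous_comp _ _ _ phi (fun z => complex.Im (set_val z))).
  exact: char_continuous.
exact: Im_continuous.
Qed.

Lemma charReD phi x y : charRe phi (x + y) =
  charRe phi x * charRe phi y - charIm phi x * charIm phi y.
Proof.
by rewrite /charRe /charIm charD; case: (set_val _) => ? ?; case: (set_val _).
Qed.

Lemma charImD phi x y : charIm phi (x + y) =
  charRe phi x * charIm phi y + charIm phi x * charRe phi y.
Proof.
by rewrite /charRe /charIm charD; case: (set_val _) => ? ?; case: (set_val _).
Qed.

Lemma char_sqrD phi x : charRe phi x ^+ 2 + charIm phi x ^+ 2 = 1.
Proof. exact: circle_sqrD. Qed.

Lemma char_ext phi psi :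
  charRe phi =1 charRe psi -> charIm phi =1 charIm psi -> phi = psi.
Proof.
move=> eRe eIm; have e : char_fun phi = char_fun psi.
  apply/funext => x; apply: val_inj; apply/eqP; rewrite eq_complex.
  by apply/andP; split; apply/eqP; [exact: eRe|exact: eIm].
case: phi psi e {eRe eIm} => f cf fD [g cg gD] /= fg.
by subst g; congr Character; exact: Prop_irrelevance.
Qed.

(** The real and imaginary parts of [phi] times the conjugate of [psi]. *)
Definition char_dot phi psi : X -> R := fun x =>
  charRe phi x * charRe psi x + charIm phi x * charIm psi x.
Definition char_cross phi psi : X -> R := fun x =>
  charIm phi x * charRe psi x - charRe phi x * charIm psi x.

Lemma char_dot_continuous phi psi : continuous (char_dot phi psi).
Proof.
move=> x; apply: (@continuousD R R X (fun x => charRe phi x * charRe psi x)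
    (fun x => charIm phi x * charIm psi x)); apply: continuousM;
  first [exact: charRe_continuous | exact: charIm_continuous].
Qed.

Lemma char_cross_continuous phi psi : continuous (char_cross phi psi).
Proof.
move=> x; apply: (@continuousB R R X (fun x => charIm phi x * charRe psi x)
    (fun x => charRe phi x * charIm psi x)); apply: continuousM;
  first [exact: charRe_continuous | exact: charIm_continuous].
Qed.

Lemma char_dot1_eq phi psi : (forall x, char_dot phi psi x = 1) -> phi = psi.
Proof.
move=> dot1; have eq2 x :
    charRe phi x = charRe psi x /\ charIm phi x = charIm psi x.
  have e1 := dot1 x; rewrite /char_dot in e1.
  have e2 := char_sqrD phi x; have e3 := char_sqrD psi x.
  have : (charRe phi x - charRe psi x) ^+ 2 +
         (charIm phi x - charIm psi x) ^+ 2 = 0 by nra.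
  move/eqP; rewrite paddr_eq0 ?sqr_ge0// !sqrf_eq0 !subr_eq0.
  by move=> /andP[/eqP ? /eqP].
by apply: char_ext => x; case: (eq2 x).
Qed.

Variable mu : probability (borel X) R.
Hypotheses (X_compact : compact [set: X]) (mu_haar : haar_probability mu).

(** The quotient [phi / psi] is a character, with value different from 1 at
    some [a]. Translating by [a] multiplies its integral by this value and
    also leaves the integral unchanged, so the integral is zero. In real
    coordinates, multiplication by the value at [a] is the matrix with entries
    [h a], [- k a], [k a], [h a] below. *)
Lemma char_orthogonal phi psi : phi <> psi ->
  \int[mu]_x char_dot phi psi (x : X) = 0.
Proof.
move=> neq.
have [a na] : exists a, char_dot phi psi a <> 1.
  apply: contrapT => /forallNP all1; apply: neq; apply: char_dot1_eq => x.
  exact: contrapT (all1 x).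
set h := char_dot phi psi; set k := char_cross phi psi.
have ch : continuous h by exact: char_dot_continuous.
have ck : continuous k by exact: char_cross_continuous.
have ih := continuous_integrable X_compact mu ch.
have ik := continuous_integrable X_compact mu ck.
have hD x : h (a + x) = h a * h x - k a * k x.
  by rewrite /h /k /char_dot /char_cross !charReD !charImD; ring.
have kD x : k (a + x) = k a * h x + h a * k x.
  by rewrite /h /k /char_dot /char_cross !charReD !charImD; ring.
have iZ (c : R) (f : X -> R) : continuous f ->
    mu.-integrable [set: borel X] (EFin \o (fun x : borel X => c * f x)).
  move=> cf.
  apply: (continuous_integrable X_compact mu (f := fun x => c * f x)).
  by move=> x; apply: continuousM; [exact: cvg_cst|exact: cf].
have Eh : \int[mu]_x h (x : X) =
    h a * \int[mu]_x h (x : X) - k a * \int[mu]_x k (x : X).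
  rewrite -[LHS](haar_Rintegral_translate X_compact mu_haar a ch).
  under eq_Rintegral do rewrite hD.
  by rewrite RintegralB//; [rewrite !RintegralZl|exact: iZ|exact: iZ].
have Ek : \int[mu]_x k (x : X) =
    k a * \int[mu]_x h (x : X) + h a * \int[mu]_x k (x : X).
  rewrite -[LHS](haar_Rintegral_translate X_compact mu_haar a ck).
  under eq_Rintegral do rewrite kD.
  by rewrite RintegralD//; [rewrite !RintegralZl|exact: iZ|exact: iZ].
move: Eh Ek; set H := \int[mu]_x _; set K := \int[mu]_x _ => Eh Ek.
(* The factor is the determinant of the linear system satisfied by H and K. *)
have : ((1 - h a) ^+ 2 + k a ^+ 2) * H = 0.
  have -> : ((1 - h a) ^+ 2 + k a ^+ 2) * H =
    (1 - h a) * (H - (h a * H - k a * K)) - k a * (K - (k a * H + h a * K)).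
    by ring.
  by rewrite -Eh -Ek !subrr !mulr0 subrr.
move=> /eqP; rewrite mulf_eq0 => /orP[|/eqP//].
by rewrite paddr_eq0 ?sqr_ge0// sqrf_eq0 subr_eq0 => /andP[/eqP/esym/na].
Qed.

Lemma char_dot_self phi : \int[mu]_x char_dot phi phi (x : X) = 1.
Proof.
under eq_Rintegral do rewrite /char_dot -!expr2 char_sqrD.
rewrite Rintegral_cst// mul1r.
exact: (congr1 fine (probability_setT mu)).
Qed.

(** The squared modulus of the partial sum of the characters. *)
Definition char_sum_sqr (phi : nat -> dual_group R X) n (x : X) : R :=
  (\sum_(i < n) charRe (phi i) x) ^+ 2 + (\sum_(i < n) charIm (phi i) x) ^+ 2.

Lemma char_sum_sqrE (phi : nat -> dual_group R X) n x :
  char_sum_sqr phi n x = \sum_(i < n) \sum_(j < n) char_dot (phi i) (phi j) x.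
Proof.
rewrite /char_sum_sqr !expr2 !big_distrl/= -big_split/=.
apply: eq_bigr => i _; rewrite !big_distrr/= -big_split/=.
by apply: eq_bigr => j _.
Qed.

Lemma sum_char_dot_continuous (phi : nat -> dual_group R X) psi n :
  continuous (fun x => \sum_(j < n) char_dot psi (phi j) x).
Proof.
apply: (continuous_sum (f := fun j => char_dot psi (phi j))) => j.
exact: char_dot_continuous.
Qed.

Lemma char_sum_sqr_continuous (phi : nat -> dual_group R X) n :
  continuous (char_sum_sqr phi n).
Proof.
rewrite (_ : char_sum_sqr phi n = fun x =>
  \sum_(i < n) \sum_(j < n) char_dot (phi i) (phi j) x).
  apply: (continuous_sum
    (f := fun i x => \sum_(j < n) char_dot (phi i) (phi j) x)) => i.
  exact: sum_char_dot_continuous.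
by apply/funext => x; exact: char_sum_sqrE.
Qed.

Lemma char_sum_sqr_integral (phi : nat -> dual_group R X) n :
  injective phi -> \int[mu]_x char_sum_sqr phi n (x : X) = n%:R.
Proof.
move=> phi_inj; under eq_Rintegral do rewrite char_sum_sqrE.
rewrite (Rintegral_sum_continuous X_compact mu
  (f := fun i x => \sum_(j < n) char_dot (phi i) (phi j) x)); last first.
  by move=> i; exact: sum_char_dot_continuous.
rewrite (eq_bigr (fun=> 1)); first by rewrite sumr_const card_ord.
move=> i _; rewrite (Rintegral_sum_continuous X_compact mu
  (f := fun j x => char_dot (phi i) (phi j) x)); last first.
  by move=> j; exact: char_dot_continuous.
rewrite (bigD1 i)//= char_dot_self big1 ?addr0// => j ji.
apply: char_orthogonal => /phi_inj ij.
by move: ji; rewrite -val_eqE /= ij eqxx.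
Qed.

End characters.

(** * Points of convergence form a null set *)

Section null.
Variables (R : realType) (X : topologicalZmodType).
Variable phi : nat -> dual_group R X.
Hypothesis phi_inj : injective phi.

(** Let [y] be the limit of [phi n x] along [E]. The modulus of the sum of the
    [phi i x] is at least its component in the direction [y]. Each term
    contributes at least [3/4] to this component when its index is in [E],
    except for finitely many indices, and at least [-1] otherwise. As the
    indices of the first kind have density 1, the component eventually exceeds
    [n / 2]. *)
Lemma filter_conv_char_sum (x : X) :
  filter_conv_set (density_filter R phi) x ->
  exists m : nat, forall n, (m <= n)%N -> n%:R ^+ 2 / 4 <= char_sum_sqr phi n x.
Proof.
move=> [B /density_filterP[E dE EB] [y _ Bx]].
pose p := complex.Re (set_val y); pose q := complex.Im (set_val y).
have pq1 : p ^+ 2 + q ^+ 2 = 1 := circle_sqrD y.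
pose dot (z : circle R) :=
  complex.Re (set_val z) * p + complex.Im (set_val z) * q.
have nbhsU : nbhs y [set z | 3 / 4 < dot z].
  have cdot : {for y, continuous dot}.
    apply: (@continuousD R R (circle R)
      (fun z : circle R => complex.Re (set_val z) * p)
      (fun z : circle R => complex.Im (set_val z) * q));
    apply: continuousM; first [exact: Re_continuous | exact: Im_continuous
      | exact: cst_continuous].
  apply: (@cvgr_gt _ _ _ (nbhs_filter y) dot _ cdot).
  by rewrite /dot -/p -/q -!expr2 pq1; lra.
pose S := phi @^-1` (B `&` [set psi | ~ (3 / 4 < dot (psi x))]).
have finS : finite_set S.
  apply: finite_preimage; last exact: (Bx _ nbhsU).
  by move=> ? ? _ _; exact: phi_inj.
have /has_densityE dG := has_density1I dE (has_density_cofinite finS).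
set G := E `&` ~` S in dG.
have G34 i : G i -> 3 / 4 < dot (phi i x).
  move=> [Ei nS]; apply: contrapT => ni; apply: nS; split=> //.
  by apply: EB; exists i.
(* A proportion 6/7 of good indices gives at least 7/4 * 6/7 - 1 = 1/2. *)
have : \forall n \near \oo, 6 / 7 < (\sum_(i < n) \1_G (i : nat)) / n%:R :> R.
  by apply: (cvgr_gt _ dG); lra.
move=> [m _ Hm]; exists m.+1 => n mn.
have n0 : 0 < n%:R :> R by rewrite ltr0n (leq_trans _ mn).
have {Hm} := Hm n (ltnW mn); rewrite /= ltr_pdivlMr// => Gn.
set A := \sum_(i < n) charRe (phi i) x; set C := \sum_(i < n) charIm (phi i) x.
have low : 7 / 4 * \sum_(i < n) \1_G (i : nat) - n%:R <= A * p + C * q.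
  rewrite /A /C !big_distrl/= -big_split/= big_distrr/=.
  have -> : n%:R = \sum_(i < n) (1 : R) by rewrite sumr_const card_ord.
  rewrite lerBlDr -big_split/=; apply: ler_sum => i _.
  rewrite indicE; have [/set_mem/G34 lt_dot|_] := boolP ((i : nat) \in G).
    move: lt_dot.
    rewrite -[dot _]/(charRe (phi i) x * p + charIm (phi i) x * q).
    by rewrite /= mulr1 => ?; lra.
  have := char_sqrD (phi i) x.
  set a := charRe _ _; set b := charIm _ _ => ab1.
  have : 0 <= (a + p) ^+ 2 + (b + q) ^+ 2 by rewrite addr_ge0 ?sqr_ge0.
  by rewrite /= mulr0; nra.
rewrite /char_sum_sqr -/A -/C.
have cauchy_schwarz : (A * p + C * q) ^+ 2 <= A ^+ 2 + C ^+ 2.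
  have -> : A ^+ 2 + C ^+ 2 = (A * p + C * q) ^+ 2 + (A * q - C * p) ^+ 2.
    by rewrite -[LHS]mulr1 -pq1; ring.
  by rewrite lerDl sqr_ge0.
have half : n%:R / 2 <= A * p + C * q by lra.
apply: le_trans cauchy_schwarz.
have -> : n%:R ^+ 2 / 4 = (n%:R / 2) ^+ 2 :> R by field.
by rewrite ler_sqr ?nnegrE//; lra.
Qed.

Variable mu : probability (borel X) R.
Hypotheses (X_compact : compact [set: X]) (mu_haar : haar_probability mu).

(** Markov's inequality for [char_sum_sqr], whose integral is [n]. *)
Lemma char_sum_sqr_tail n : (0 < n)%N ->
  (mu [set x : borel X | (n%:R ^+ 2 / 4 <= char_sum_sqr phi n x)%R] <=
   (4 / n%:R)%:E)%E.
Proof.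
move=> n0; have n0R : 0 < n%:R :> R by rewrite ltr0n.
pose f : borel X -> R := char_sum_sqr phi n.
have f0 x : 0 <= f x by rewrite addr_ge0 ?sqr_ge0.
have cf : continuous (char_sum_sqr phi n) by exact: char_sum_sqr_continuous.
have a0 : 0 < n%:R ^+ 2 / 4 :> R by rewrite divr_gt0// exprn_gt0.
have mf := iffRL (measurable_EFinP _ _) (continuous_borel_measurable cf).
have int : (\int[mu]_x `|(f x)%:E| = (n%:R)%R%:E)%E.
  under eq_integral do rewrite gee0_abs ?lee_fin//.
  rewrite -(char_sum_sqr_integral X_compact mu_haar n phi_inj) /Rintegral.
  rewrite fineK//; apply: (integrable_fin_num measurableT
    (continuous_integrable X_compact mu cf)).
have := le_integral_comp_abse mu measurableT (f := id) (g := EFin \o f)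
  (@measurable_id _ _ setT) (fun r h => h) (fun x y _ _ h => h) mf a0.
rewrite [X in (_ <= X)%E]int setTI -lee_pdivlMl// -EFinM.
have -> : (n%:R ^+ 2 / 4)^-1 * n%:R = 4 / n%:R :> R by field; rewrite lt0r_neq0.
apply: le_trans; rewrite le_eqVlt; apply/orP; left; apply/eqP; congr (mu _).
by apply/seteqP; split=> x /=; rewrite lee_fin ger0_norm.
Qed.

Lemma filter_conv_negligible :
  mu.-negligible (filter_conv_set (density_filter R phi) : set (borel X)).
Proof.
pose Z m : set (borel X) := \bigcap_(n in [set n | (m <= n)%N])
  [set x | n%:R ^+ 2 / 4 <= char_sum_sqr phi n x].
apply: (@negligibleS _ _ _ _ (\bigcup_m Z m)).
  by move=> x /filter_conv_char_sum[m Hm]; exists m.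
apply: negligible_bigcup => m.
have mT n : measurable
    ([set x | n%:R ^+ 2 / 4 <= char_sum_sqr phi n x] : set (borel X)).
  have cf : continuous (char_sum_sqr phi n) by exact: char_sum_sqr_continuous.
  rewrite -[X in measurable X]setTI.
  exact: (measurable_fun_le measurableT (measurable_cst _)
    (continuous_borel_measurable cf)).
have mZ : measurable (Z m).
  by apply: bigcap_measurable => [|n _]; [exists m => /=|exact: (mT n)].
apply/negligibleP => //; apply/eqP; rewrite eq_le measure_ge0 andbT.
apply/lee_addgt0Pr => e e0; rewrite add0e.
near \oo => n.
have n0 : (0 < n)%N by near: n; exact: nbhs_infty_gt.
have mn : (m <= n)%N by near: n; exact: nbhs_infty_ge.
apply: (@le_trans _ _ (4 / n%:R)%:E).
  apply: le_trans (char_sum_sqr_tail n0).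
  by apply: le_measure; rewrite ?inE//; exact: bigcap_inf.
rewrite lee_fin ler_pdivrMr ?ltr0n// mulrC -ler_pdivrMr//.
by near: n; exact: nbhs_infty_ger.
Unshelve. all: by end_near. Qed.

End null.

Theorem proposition1p8 (R : realType) (X : topologicalZmodType)
    (X_compact : compact [set: X]) (X_hausdorff : hausdorff_space X)
    (mu : probability (borel X) R) (mu_haar : haar_probability mu)
    (phi : nat -> dual_group R X) (phi_inj : injective phi) :
  let D : set X := filter_conv_set (density_filter R phi) in
  GRing.zmod_closed [in D] /\ mu.-negligible D.
Proof.
split; first exact: filter_conv_set_zmod_closed (smallest_filter_filter _).
exact: (filter_conv_negligible phi_inj X_compact mu_haar).
Qed.
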